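(* Let $\mathcal{A}=\{H_1,\dots,H_n\}$ be a real line arrangement in $\mathbb{R}^2$ normalized as described in the context, let $C\in\mathrm{ch}_F(\mathcal{A})$, and let $P=(x_1,x_2)\in C$ with $1<x_2<R_0$. Put $$\boldsymbol{a}_1=\boldsymbol{a}_1(P)=(x_1-x_2+1-\rho(x_2),\,1-\rho(x_2)),\qquad \boldsymbol{a}_2=\boldsymbol{a}_2(P)=(x_1+x_2-1+\rho(x_2),\,1-\rho(x_2)).$$ Then the attaching circle of the $2$-handle $h^2(C)$ is equal to $\mathbb{S}(\boldsymbol{a}_1,\boldsymbol{a}_2)$, with zero framing.
   Context: **Complement.** A real line arrangement $\mathcal{A}=\{H_1,\dots,H_n\}$ is a finite set of affine lines in $\mathbb{R}^2$, with $H_i=\{\alpha_i=0\}$ for an affine linear form $\alpha_i$ with real coefficients. $H_{i,\mathbb{C}}\subset\mathbb{C}^2$ is the complex line defined by the same equation, and $M(\mathcal{A})=\mathbb{C}^2\smallsetminus\bigcup_i H_{i,\mathbb{C}}$. Identify $T\mathbb{R}^2$ with $\mathbb{C}^2$ by $(\boldsymbol{x},\boldsymbol{y})\mapsto \boldsymbol{x}+\sqrt{-1}\,\boldsymbol{y}$ ($\boldsymbol{x}\in\mathbb{R}^2$, $\boldsymbol{y}\in T_{\boldsymbol{x}}\mathbb{R}^2$); $\boldsymbol{x}$ is called the real part. A chamber is a connected component of $\mathbb{R}^2\smallsetminus\bigcup_i H_i$; $\mathrm{ch}(\mathcal{A})$ is the set of chambers. **Normalization.** $F=\{x_2=0\}$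 is a generic line with respect to $\mathcal{A}$, and all intersection points of $\mathcal{A}$ lie in $\{1<x_2<R_0\}$ for some $R_0>0$. $\mathrm{ch}_F(\mathcal{A})=\{C\in\mathrm{ch}(\mathcal{A}) : C\cap F=\emptyset\}$. $H_i\cap F=(a_i,0)$ with $a_1<\dots<a_n$, and the sign of $\alpha_i$ is such that $\{\alpha_i<0\}$ contains the negative (left) direction of $F$ and $\{\alpha_i>0\}$ the positive (right) direction. The angle $\theta_i$ from the positive $x_1$-axis to $H_i$ satisfies $\frac{\pi}{4}\le\theta_1\le\dots\le\theta_n\le\frac{3\pi}{4}$. $R\gg R_0$ is a sufficiently large real number, so that in particular all points $H_i\cap\{x_2=R_0\}$ lie in $\{-R+R_0<x_1<R-R_0\}$. **PL sphere and disk.** $\|(y_1,y_2)\|_\infty=\max\{|y_1|,|y_2|\}$, $\mathrm{Rect}(R,1)=[-R,R]\times[-1,1]$, and $\delta(\boldsymbol{x})=\min\{x_1+R,R-x_1,x_2+1,1-x_2\}$ for $\boldsymbol{x}\in\mathrm{Rect}(R,1)$. Put $\mathtt{D}^4(R,1)=\{(\boldsymbol{x},\boldsymbol{y}) : \boldsymbol{x}\in\mathrm{Rect}(R,1),\ \|\boldsymbol{y}\|_\infty\le\delta(\boldsymbol{x})\}\approx D^4$, with boundary $\mathtt{S}^3(R,1)=\{(\boldsymbol{x},\boldsymbol{y}) : \boldsymbol{x}\in\mathrm{Rect}(R,1),\ \|\boldsymbol{y}\|_\infty=\delta(\boldsymbol{x})\}\approx S^3$. **The circles $\mathbb{S}(\boldsymbol{a}_1,\boldsymbol{a}_2)$.**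 For $\boldsymbol{a}_1=(a_1,b)$, $\boldsymbol{a}_2=(a_2,b)\in\mathrm{Rect}(R,1)$ with $a_1\le a_2$, $|a_1|,|a_2|\ll R$, $0\le b<1$ (here $a_1,a_2$ denote the abscissas of these two points), $\mathbb{S}(\boldsymbol{a}_1,\boldsymbol{a}_2)\subset\mathtt{S}^3(R,1)$ is the image of the map $G$ on the boundary of the square $\partial([-1,1]^2)$ defined for $\boldsymbol{v}=(v_1,v_2)$ by $$G(\boldsymbol{v})=\begin{cases}\left(\left(\frac{a_2-a_1}{2}v_1+\frac{a_1+a_2}{2},b\right),(1-b)\boldsymbol{v}\right)& v_2=-1,\\ \left(\left(\frac{a_1-a_2}{2}v_2+\frac{a_1+a_2}{2},b\right),(1-b)\boldsymbol{v}\right)& v_1=1,\\ \left(\left(\frac{a_1-a_2}{2}v_1+\frac{a_1+a_2}{2},b\right),(1-b)\boldsymbol{v}\right)& v_2=1,\\ \left(\left(\frac{a_2-a_1}{2}v_2+\frac{a_1+a_2}{2},b\right),(1-b)\boldsymbol{v}\right)& v_1=-1.\end{cases}$$ **Handle decomposition.** Let $\widetilde{H}_{i,\mathbb{C}}$ be a small tubular neighborhood of $H_{i,\mathbb{C}}$. $M(\mathcal{A})$ is homeomorphic to the interior of the handlebody obtained as follows. The $0$-handle is $\mathtt{D}^4(R,1)$; removing from it the neighborhoods of the disks $\mathtt{D}^4(R,1)\cap H_{i,\mathbb{C}}$ gives the $1$-handlebody $M_4=\mathtt{D}^4(R,1)\smallsetminus\bigcup_i\widetilde{H}_{i,\mathbb{C}}$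 (the dotted circles of the Kirby diagram are $\mathtt{S}^3(R,1)\cap H_{i,\mathbb{C}}$). For each $C\in\mathrm{ch}_F(\mathcal{A})$ a $2$-handle $h^2(C)$ is attached to $M_4$. Put $\rho(h)=\frac{h-1}{R_0-1}$ for $h\in[1,R_0]$ and define $$\sigma(\boldsymbol{x},\boldsymbol{y})=\begin{cases}\left(\left(x_1-\frac{y_1}{y_2}(x_2-1+\|\boldsymbol{y}\|_\infty),\,1-\|\boldsymbol{y}\|_\infty\right),\boldsymbol{y}\right) & x_2\ge1-\|\boldsymbol{y}\|_\infty,\ |y_1|\le|y_2|,\\ \left(\left(x_1-\frac{y_2}{y_1}(x_2-1+\|\boldsymbol{y}\|_\infty),\,1-\|\boldsymbol{y}\|_\infty\right),\boldsymbol{y}\right) & x_2\ge1-\|\boldsymbol{y}\|_\infty,\ |y_1|\ge|y_2|,\\ (\boldsymbol{x},\boldsymbol{y}) & x_2\le1-\|\boldsymbol{y}\|_\infty,\end{cases}$$ and $\sigma_t=(1-t)\,\mathrm{id}+t\,\sigma$. The $2$-handle $h^2(C)$ is the union of $\{(\boldsymbol{x},\boldsymbol{y}) : \boldsymbol{x}\in C,\ \|\boldsymbol{y}\|_\infty\le\rho(x_2)\}$ and $\{\sigma_t(\boldsymbol{x},\boldsymbol{y}) : \boldsymbol{x}\in C,\ \|\boldsymbol{y}\|_\infty=\rho(x_2),\ 0\le t\le1\}$ (with $\boldsymbol{x}$ in the range $1<x_2\le R_0$). Its core is the part lying over the chosen point $P=(x_1,x_2)\in C$ (i.e. $\boldsymbol{x}=P$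 in both sets), and its attaching circle is $\{\sigma(P,\boldsymbol{y}) : \|\boldsymbol{y}\|_\infty=\rho(x_2)\}\subset\mathtt{S}^3(R,1)$. The framing is given by the parallel copies of this circle obtained from other points $P'\in C$ near $P$, and is measured as an integer by the linking number in $\mathtt{S}^3(R,1)$. *)

(* Defs.v *)
From HB Require Import structures.
From mathcomp Require Import all_boot all_order all_algebra.
From mathcomp Require Import ring lra.
From mathcomp Require Import all_classical all_reals all_analysis.

Set Implicit Arguments.
Unset Strict Implicit.
Unset Printing Implicit Defensive.

Import Order.TTheory GRing.Theory Num.Theory.
Import numFieldNormedType.Exports.

Local Open Scope classical_set_scope.
Local Open Scope ring_scope.

Notation plane R := (R * R)%type.

(* (x, y) is x + sqrt(-1) y, i.e. y a tangent vector of R^2 at x *)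
Notation cplane R := (plane R * plane R)%type.

Section Arrangements.
Variable R : realType.

(* the affine form lin1 x_1 + lin2 x_2 + cst *)
Record affine_form := AffineForm { lin1 : R ; lin2 : R ; cst : R }.

Definition aeval (f : affine_form) (x : plane R) : R :=
  lin1 f * x.1 + lin2 f * x.2 + cst f.

Definition line (f : affine_form) : set (plane R) := [set x | aeval f x = 0].

Definition line_arrangement n (A : 'I_n -> affine_form) : Prop :=
  (forall i, (lin1 (A i), lin2 (A i)) != (0, 0)) /\
  injective (fun i => line (A i)).

Definition complement n (A : 'I_n -> affine_form) : set (plane R) :=
  ~` \bigcup_i line (A i).

Definition chambers n (A : 'I_n -> affine_form) : set (set (plane R)) :=
  [set connected_component (complement A) x | x in complement A].

Definition Fline : set (plane R) := [set x | x.2 = 0].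

Definition chF n (A : 'I_n -> affine_form) : set (set (plane R)) :=
  [set C | chambers A C /\ C `&` Fline = set0].

Definition generic_line n (A : 'I_n -> affine_form) (L : set (plane R)) : Prop :=
  (forall i, exists p, line (A i) `&` L = [set p]) /\
  (forall i j, i != j -> line (A i) `&` line (A j) `&` L = set0).

(* The last field but one says that (cos theta_i, sin theta_i) directs H_i. *)
Record normalized n (A : 'I_n -> affine_form) (a theta : 'I_n -> R) (R0 : R) :
    Prop := Normalized {
  norm_arrangement : line_arrangement A ;
  norm_R0_gt0 : 0 < R0 ;
  norm_generic : generic_line A Fline ;
  norm_crossing : forall i j x, i != j -> line (A i) x -> line (A j) x ->
    1 < x.2 < R0 ;
  norm_abscissa : forall i, line (A i) `&` Fline = [set (a i, 0)] ;
  norm_abscissa_lt : forall i j : 'I_n, (i < j)%N -> a i < a j ;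
  norm_neg : forall i t, t < a i -> aeval (A i) (t, 0) < 0 ;
  norm_pos : forall i t, a i < t -> 0 < aeval (A i) (t, 0) ;
  norm_angle_itv : forall i, pi / 4 <= theta i <= 3 * pi / 4 ;
  norm_angle : forall i, lin1 (A i) * cos (theta i) + lin2 (A i) * sin (theta i) = 0 ;
  norm_angle_le : forall i j : 'I_n, (i <= j)%N -> theta i <= theta j }.

End Arrangements.

Section Sphere.
Variable R : realType.

Definition supnorm (y : plane R) : R := Num.max `|y.1| `|y.2|.

Definition Rect (r : R) : set (plane R) :=
  [set x | - r <= x.1 <= r /\ -1 <= x.2 <= 1].

Definition delta (r : R) (x : plane R) : R :=
  Num.min (Num.min (x.1 + r) (r - x.1)) (Num.min (x.2 + 1) (1 - x.2)).

Definition D4 (r : R) : set (cplane R) :=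
  [set z | Rect r z.1 /\ supnorm z.2 <= delta r z.1].

Definition S3 (r : R) : set (cplane R) :=
  [set z | Rect r z.1 /\ supnorm z.2 = delta r z.1].

(* the boundary of [-1, 1]^2 *)
Definition square : set (plane R) := [set v | supnorm v = 1].

(* The cases agree at the corners of the square, so their order is irrelevant. *)
Definition Gmap (p q : plane R) (v : plane R) : cplane R :=
  let b := p.2 in
  let m := (p.1 + q.1) / 2 in
  let x1 := if v.2 == -1 then (q.1 - p.1) / 2 * v.1 + m
            else if v.1 == 1 then (p.1 - q.1) / 2 * v.2 + m
            else if v.2 == 1 then (p.1 - q.1) / 2 * v.1 + m
            else (q.1 - p.1) / 2 * v.2 + m in
  ((x1, b), (1 - b) *: v).

(* the standing requirements on the pair of points in the notation S(p, q) *)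
Definition SS_admissible (r : R) (p q : plane R) : Prop :=
  [/\ p.2 = q.2, p.1 <= q.1, 0 <= p.2 < 1, Rect r p & Rect r q].

Definition SS (p q : plane R) : set (cplane R) := Gmap p q @` square.

End Sphere.

(* Linking number of two disjoint oriented closed polygons K, K' in the PL     *)
(* sphere S3 r = boundary of the ball D4 r: the algebraic intersection number  *)
(* S . S' of integral PL 2-chains S, S' in D4 r which bound K and K' and meet  *)
(* transversally; the value does not depend on the choice of S and S'.         *)
Section Linking.
Variable R : realType.
Notation pt := (cplane R).

(* the closed polygon with cyclic sequence of vertices K *)
Definition edges (K : seq pt) : seq (pt * pt) := zip K (rot 1 K).

Definition segment (e : pt * pt) : set pt :=
  [set (1 - t) *: e.1 + t *: e.2 | t in [set t : R | 0 <= t <= 1]].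

Definition polygon (K : seq pt) : set pt :=
  [set z | exists2 e, e \in edges K & segment e z].

Definition triangle : Type := (pt * pt * pt)%type.

(* a list of oriented triangles stands for their sum; reversing the order of   *)
(* the vertices of a triangle changes its sign                                 *)
Definition chain := seq triangle.

Definition tri_edges (T : triangle) : seq (pt * pt) :=
  let: (p, q, s) := T in [:: (p, q); (q, s); (s, p)].

Definition chain_edges (S : chain) : seq (pt * pt) :=
  flatten [seq tri_edges T | T <- S].

Definition edge_coef (s : seq (pt * pt)) (p q : pt) : int :=
  (count_mem (p, q) s)%:Z - (count_mem (q, p) s)%:Z.

Definition bounds (S : chain) (K : seq pt) : Prop :=
  forall p q, edge_coef (chain_edges S) p q = edge_coef (edges K) p q.

Definition chain_in (D : set pt) (S : chain) : Prop :=
  forall T, T \in S -> [/\ D T.1.1, D T.1.2 & D T.2].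

Definition barycentric (c : R * R * R) : Prop :=
  [/\ 0 <= c.1.1, 0 <= c.1.2, 0 <= c.2 & c.1.1 + c.1.2 + c.2 = 1].

Definition inner (c : R * R * R) : Prop := [/\ 0 < c.1.1, 0 < c.1.2 & 0 < c.2].

Definition tri_point (T : triangle) (c : R * R * R) : pt :=
  c.1.1 *: T.1.1 + c.1.2 *: T.1.2 + c.2 *: T.2.

(* complex orientation of C^2: real coordinates in the order x_1, y_1, x_2, y_2 *)
Definition coords (z : pt) : seq R := [:: z.1.1; z.2.1; z.1.2; z.2.2].

Definition det4 (u v w z : pt) : R :=
  \det (\matrix_(i < 4, j < 4) (coords ([:: u; v; w; z]`_i))`_j).

Definition tri_det (T T' : triangle) : R :=
  det4 (T.1.2 - T.1.1) (T.2 - T.1.1) (T'.1.2 - T'.1.1) (T'.2 - T'.1.1).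

Definition tri_meet (T T' : triangle) : Prop :=
  exists c c', [/\ barycentric c, barycentric c' & tri_point T c = tri_point T' c'].

Definition tri_transverse (T T' : triangle) : Prop :=
  forall c c', barycentric c -> barycentric c' -> tri_point T c = tri_point T' c' ->
    [/\ inner c, inner c' & tri_det T T' != 0].

Definition transverse (S S' : chain) : Prop :=
  forall T T', T \in S -> T' \in S' -> tri_transverse T T'.

Definition intersection_number (S S' : chain) : int :=
  \sum_(T <- S) \sum_(T' <- S')
    if `[< tri_meet T T' >] then sgz (tri_det T T') else 0.

Definition linking_number (r : R) (K K' : seq pt) (m : int) : Prop :=
  [/\ polygon K `<=` S3 r, polygon K' `<=` S3 r, polygon K `&` polygon K' = set0 &
   exists S S' : chain,
     [/\ chain_in (D4 r) S /\ chain_in (D4 r) S', bounds S K, bounds S' K',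
         transverse S S' & intersection_number S S' = m]].

End Linking.

Section Handles.
Variable R : realType.

Definition rho (R0 h : R) : R := (h - 1) / (R0 - 1).

Definition sigma (z : cplane R) : cplane R :=
  let x := z.1 in let y := z.2 in
  if x.2 <= 1 - supnorm y then z
  else if `|y.1| <= `|y.2| then
    ((x.1 - y.1 / y.2 * (x.2 - 1 + supnorm y), 1 - supnorm y), y)
  else
    ((x.1 - y.2 / y.1 * (x.2 - 1 + supnorm y), 1 - supnorm y), y).

Definition sigma_t (t : R) (z : cplane R) : cplane R := (1 - t) *: z + t *: sigma z.

(* the part of the handle lying over X: h^2(C) for X = C, its core for X = [set P] *)
Definition handle_over (R0 : R) (X : set (plane R)) : set (cplane R) :=
  [set z | [/\ X z.1, 1 < z.1.2 <= R0 & supnorm z.2 <= rho R0 z.1.2]] `|`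
  [set w | exists z t, [/\ X z.1, 1 < z.1.2 <= R0, supnorm z.2 = rho R0 z.1.2,
                           0 <= t <= 1 & w = sigma_t t z]].

Definition attaching_circle (R0 : R) (P : plane R) : set (cplane R) :=
  [set sigma (P, y) | y in [set y | supnorm y = rho R0 P.2]].

Definition corners : seq (plane R) := [:: (-1, -1); (1, -1); (1, 1); (-1, 1)].

(* The attaching circle as a closed polygon, oriented counterclockwise in y;   *)
(* see attaching_polygonE.                                                     *)
Definition attaching_polygon (R0 : R) (P : plane R) : seq (cplane R) :=
  [seq sigma (P, rho R0 P.2 *: v) | v <- corners].

Definition framing (r R0 : R) (C : set (plane R)) (P : plane R) (m : int) : Prop :=
  \forall P' \near P^', C P' ->
    linking_number r (attaching_polygon R0 P) (attaching_polygon R0 P') m.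

Definition a1 (R0 : R) (P : plane R) : plane R :=
  (P.1 - P.2 + 1 - rho R0 P.2, 1 - rho R0 P.2).

Definition a2 (R0 : R) (P : plane R) : plane R :=
  (P.1 + P.2 - 1 + rho R0 P.2, 1 - rho R0 P.2).

Lemma supnormP (y : plane R) (c : R) : supnorm y = c <->
  [/\ `|y.1| <= c, `|y.2| <= c & `|y.1| = c \/ `|y.2| = c].
Proof.
rewrite /supnorm; case: (leP `|y.1| `|y.2|) => h; split.
- by move=> <-; split => //; right.
- by case=> [h1 h2 [h3|//]]; apply/eqP; rewrite eq_le h2 -h3.
- by move=> <-; split => //; [exact: ltW | left].
- by case=> [h1 h2 [//|h3]]; apply/eqP; rewrite eq_le h1 -h3 ltW.
Qed.

(* sigma on the four sides of the square supnorm y = c, for x_2 > 1 *)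
Lemma sigma_side (x y : plane R) (c : R) : 1 < x.2 -> 0 < c -> supnorm y = c ->
  let k := (x.2 - 1 + c) / c in
  [/\ y.2 = - c -> sigma (x, y) = ((x.1 + k * y.1, 1 - c), y),
      y.1 = c -> sigma (x, y) = ((x.1 - k * y.2, 1 - c), y),
      y.2 = c -> sigma (x, y) = ((x.1 - k * y.1, 1 - c), y) &
      y.1 = - c -> sigma (x, y) = ((x.1 + k * y.2, 1 - c), y)].
Proof.
case: y => y1 y2 x1 c0 yc k; have c_neq0 : c != 0 by rewrite gt_eqF.
have /supnormP [/= h1 h2 _] := yc.
move: h1 h2; rewrite !ler_norml => /andP[h1 h1'] /andP[h2 h2'].
have side : (x.2 <= 1 - c) = false by apply/negbTE; rewrite -ltNge; lra.
rewrite /sigma /= yc side /k.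
split=> /= ->; rewrite ?normrN ?(gtr0_norm c0) ?ler_norml.
- by rewrite (_ : (- c <= y1 <= c)); [congr ((_, _), _); field | apply/andP].
- case: ifP => e; last by congr ((_, _), _); field.
  have [->|->] : y2 = c \/ y2 = - c.
    by move: e; rewrite ler_normr => /orP[e|e]; [left|right]; lra.
  + by congr ((_, _), _); field.
  + by congr ((_, _), _); field.
- by rewrite (_ : (- c <= y1 <= c)); [congr ((_, _), _); field | apply/andP].
- case: ifP => e; last by congr ((_, _), _); field.
  have [->|->] : y2 = c \/ y2 = - c.
    by move: e; rewrite ler_normr => /orP[e|e]; [left|right]; lra.
  + by congr ((_, _), _); field.
  + by congr ((_, _), _); field.
Qed.

Lemma attaching_polygonE R0 (P : plane R) : 1 < P.2 < R0 ->
  polygon (attaching_polygon R0 P) = attaching_circle R0 P.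
Proof.
case/andP => P1 PR.
have rho0 : 0 < rho R0 P.2 by apply: divr_gt0; lra.
rewrite /attaching_circle; set c := rho R0 P.2 in rho0 *.
pose k := (P.2 - 1 + c) / c.
pose bot t : cplane R := ((P.1 + k * (c * t), 1 - c), (c * t, - c)).
pose rig t : cplane R := ((P.1 - k * (c * t), 1 - c), (c, c * t)).
pose top t : cplane R := ((P.1 - k * (c * t), 1 - c), (c * t, c)).
pose lef t : cplane R := ((P.1 + k * (c * t), 1 - c), (- c, c * t)).
have cabs : `|c| = c by exact: gtr0_norm.
have nct (t : R) : -1 <= t <= 1 -> `|c * t| <= c.
  by move=> ht; rewrite normrM cabs ger_pMr // ler_norml.
have sup_c y1 y2 : `|y1| <= c -> `|y2| <= c -> `|y1| = c \/ `|y2| = c ->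
  supnorm (y1, y2) = c by move=> h1 h2 h3; apply/supnormP.
have sbot (t : R) : -1 <= t <= 1 -> sigma (P, (c * t, - c)) = bot t.
  move=> ht; have [//|e _ _ _] := @sigma_side P (c * t, - c) c P1 rho0.
    by apply: sup_c; rewrite ?normrN ?cabs ?nct //; right.
  by rewrite e.
have srig (t : R) : -1 <= t <= 1 -> sigma (P, (c, c * t)) = rig t.
  move=> ht; have [//|_ e _ _] := @sigma_side P (c, c * t) c P1 rho0.
    by apply: sup_c; rewrite ?normrN ?cabs ?nct //; left.
  by rewrite e.
have stop (t : R) : -1 <= t <= 1 -> sigma (P, (c * t, c)) = top t.
  move=> ht; have [//|_ _ e _] := @sigma_side P (c * t, c) c P1 rho0.
    by apply: sup_c; rewrite ?normrN ?cabs ?nct //; right.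
  by rewrite e.
have slef (t : R) : -1 <= t <= 1 -> sigma (P, (- c, c * t)) = lef t.
  move=> ht; have [//|_ _ _ e] := @sigma_side P (- c, c * t) c P1 rho0.
    by apply: sup_c; rewrite ?normrN ?cabs ?nct //; left.
  by rewrite e.
have m1 : -1 <= (-1 : R) <= 1 by lra.
have p1 : -1 <= (1 : R) <= 1 by lra.
have vert v1 v2 : c *: ((v1, v2) : plane R) = (c * v1, c * v2) by [].
have -> : attaching_polygon R0 P = [:: bot (-1); bot 1; top 1; top (-1)].
  rewrite /attaching_polygon /corners /= -/c !vert !mulrN1 !mulr1.
  by rewrite -(sbot _ m1) -(sbot _ p1) -(stop _ m1) -(stop _ p1) !mulrN1 !mulr1.
have e1 : bot 1 = rig (-1) by rewrite -sbot // -srig // !mulrN1 !mulr1.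
have e2 : top 1 = rig 1 by rewrite -stop // -srig // !mulr1.
have e3 : top (-1) = lef 1 by rewrite -stop // -slef // !mulrN1 !mulr1.
have e4 : bot (-1) = lef (-1) by rewrite -sbot // -slef // !mulrN1.
have seg (s u : R) (f : R -> cplane R) :
    (forall t, f ((1 - t) * s + t * u) = (1 - t) *: f s + t *: f u) ->
    forall t, 0 <= t <= 1 -> segment (f s, f u) (f ((1 - t) * s + t * u)).
  by move=> hf t ht; exists t => //; rewrite hf.
have lbot s u t : bot ((1 - t) * s + t * u) = (1 - t) *: bot s + t *: bot u.
  by congr ((_, _), (_, _)); rewrite /= /GRing.scale /=; ring.
have lrig s u t : rig ((1 - t) * s + t * u) = (1 - t) *: rig s + t *: rig u.
  by congr ((_, _), (_, _)); rewrite /= /GRing.scale /=; ring.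
have ltop s u t : top ((1 - t) * s + t * u) = (1 - t) *: top s + t *: top u.
  by congr ((_, _), (_, _)); rewrite /= /GRing.scale /=; ring.
have llef s u t : lef ((1 - t) * s + t * u) = (1 - t) *: lef s + t *: lef u.
  by congr ((_, _), (_, _)); rewrite /= /GRing.scale /=; ring.
apply/seteqP; split => [z [e]|_ [[y1 y2] /= /supnormP [/= h1 h2 h3] <-]].
- rewrite /edges /= !inE => /or4P[] /eqP -> [t /= /andP[t0 t1] <-] /=.
  + rewrite -lbot -sbot; last by apply/andP; split; lra.
    eexists; last reflexivity.
    by apply: sup_c; rewrite ?normrN ?cabs ?nct //; [lra|right].
  + rewrite e1 e2 -lrig -srig; last by apply/andP; split; lra.
    eexists; last reflexivity.
    by apply: sup_c; rewrite ?normrN ?cabs ?nct //; [lra|left].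
  + rewrite -ltop -stop; last by apply/andP; split; lra.
    eexists; last reflexivity.
    by apply: sup_c; rewrite ?normrN ?cabs ?nct //; [lra|right].
  + rewrite e3 e4 -llef -slef; last by apply/andP; split; lra.
    eexists; last reflexivity.
    by apply: sup_c; rewrite ?normrN ?cabs ?nct //; [lra|left].
- have unit_ (y : R) : `|y| <= c -> -1 <= y / c <= 1.
    rewrite ler_norml => /andP[u1 u2].
    by rewrite [X in X && _]ler_pdivlMr // mulN1r u1 ler_pdivrMr // mul1r.
  have cK (y : R) : c * (y / c) = y by rewrite mulrC divfK // gt_eqF.
  have up (y : R) : `|y| <= c -> exists2 t, 0 <= t <= 1 & y / c = (1 - t) * -1 + t * 1.
    by move=> /unit_ /andP[u1 u2]; exists ((y / c + 1) / 2); [lra|field; rewrite gt_eqF].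
  have down (y : R) : `|y| <= c -> exists2 t, 0 <= t <= 1 & y / c = (1 - t) * 1 + t * -1.
    by move=> /unit_ /andP[u1 u2]; exists ((1 - y / c) / 2); [lra|field; rewrite gt_eqF].
  rewrite /polygon /edges /=.
  case: h3 => h3; [have [y1c|y1c] : y1 = c \/ y1 = - c by
      move: h3; case: (ger0P y1) => _ h3; [left|right]; lra
    |have [y2c|y2c] : y2 = c \/ y2 = - c by
      move: h3; case: (ger0P y2) => _ h3; [left|right]; lra].
  + have [t ht et] := up _ h2.
    exists (bot 1, top 1); first by rewrite !inE eqxx !orbT.
    by rewrite y1c -(cK y2) srig ?unit_ // et e1 e2; apply: seg.
  + have [t ht et] := down _ h2.
    exists (top (-1), bot (-1)); first by rewrite !inE eqxx !orbT.
    by rewrite y1c -(cK y2) slef ?unit_ // et e3 e4; apply: seg.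
  + have [t ht et] := down _ h1.
    exists (top 1, top (-1)); first by rewrite !inE eqxx !orbT.
    by rewrite y2c -(cK y1) stop ?unit_ // et; apply: seg.
  + have [t ht et] := up _ h1.
    exists (bot (-1), bot 1); first by rewrite !inE eqxx.
    by rewrite y2c -(cK y1) sbot ?unit_ // et; apply: seg.
Qed.

(* the attaching circle is where the core of the handle meets the 0-handle *)
Lemma handle_over_attaching_circle r R0 (P : plane R) : 1 < P.2 <= R0 ->
  handle_over R0 [set P] `&` D4 r = attaching_circle R0 P `&` D4 r.
Proof.
move=> PR; have /andP[P1 PR'] := PR.
have rho0 : 0 < rho R0 P.2 by apply: divr_gt0; lra.
apply/seteqP; split => z [].
- case=> [[/= e _ _] [[_ /andP[_ z1]] _]|].
    by move: z1; rewrite e; lra.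
  case=> [[x y] [t [/= e _ yc /andP[t0 t1] ->]]] Dz; split => //.
  rewrite e in yc Dz *; exists y => //.
  suff -> : t = 1 by rewrite /sigma_t subrr scale0r add0r scale1r.
  have s2 : (sigma (P, y)).2 = y by rewrite /sigma /=; do 2?case: ifP.
  have s1 : (sigma (P, y)).1.2 = 1 - rho R0 P.2.
    rewrite /sigma /= yc ifF; first by case: ifP.
    by apply/negbTE; rewrite -ltNge; lra.
  case: Dz => _; rewrite /sigma_t /= s2 -scalerDl subrK scale1r yc /delta.
  rewrite !le_min => /andP[_ /andP[_]]; rewrite /= s1 /GRing.scale /= => h.
  have : (1 - t) * (P.2 - 1 + rho R0 P.2) <= 0 by lra.
  rewrite pmulr_lle0; lra.
- case=> y /= yc <- Dz; split => //; right; exists (P, y), 1; split => //=.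
  + by rewrite ler01 lexx.
  + by rewrite /sigma_t subrr scale0r add0r scale1r.
Qed.

End Handles.

(* Main.v *)
Require Import Defs.
From mathcomp Require Import all_boot all_order all_algebra.
From mathcomp Require Import ring lra.
From mathcomp Require Import all_classical all_reals all_analysis.

Import Order.TTheory GRing.Theory Num.Theory.
Import numFieldNormedType.Exports.

Local Open Scope classical_set_scope.
Local Open Scope ring_scope.

(** Write c = rho R0 P.2 and h = P.2 - 1 + c.  The idea is that the four-case
formulas for sigma on the square [supnorm y = c] and for the map G whose image
is S(a_1, a_2) are one and the same formula: on all four sides the second real
coordinate is 1 - c, the imaginary part is y, and the first real coordinate is
P.1 - h + (h / c) * |y_1 - y_2|.  This is [saddle], a square folded along its
diagonal y_1 = y_2.  Comparing the two formulas ([sigma_saddle] and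
[Gmap_saddle]) identifies the attaching circle.

The same formula makes sense on the full square [supnorm y <= c], where it
parametrizes a disk, made of two flat triangles, whose boundary is the
attaching circle.  The disk lies in D4 because D4 is convex and contains the
four corners.  A point of the disk determines P: its second real coordinate
gives rho R0 P.2, hence P.2, hence h, and then the first coordinate and y give
P.1 ([saddle_inj]).  So the disks over two distinct points P and P' are
disjoint, and the linking number of their boundaries is 0: this is the zero
framing.

It remains to choose r so large that the circles lie in the sphere S3 r,
uniformly in P.  Every line of the arrangement crosses F, hence leaves the strip
0 <= x_2 <= R0 through its bottom and top, and meets the strip in a bounded set.
Thus when |P.1| is large, the vertical segment from P down to F avoids all the
lines, and the chamber of P meets F ([chF_bounded]). *)

(** * The folded square *)

Section Saddle.
Context {R : realType}.
Implicit Types (r : R) (P y v : plane R).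

Definition saddle (R0 : R) P y : cplane R :=
  let c := rho R0 P.2 in let h := P.2 - 1 + c in
  ((P.1 - h + h / c * `|y.1 - y.2|, 1 - c), y).

Lemma rho_itv (R0 : R) (h : R) : 1 < h < R0 -> 0 < rho R0 h < 1.
Proof.
case/andP=> h1 hR; have d0 : 0 < R0 - 1 by lra.
by rewrite /rho divr_gt0 ?ltr_pdivrMr //=; lra.
Qed.

Lemma rho_inj (R0 : R) : 1 < R0 -> injective (rho R0).
Proof.
move=> R1 h h'; rewrite /rho => /mulIf; rewrite invr_neq0; last lra.
by move=> /(_ isT) e; lra.
Qed.

(** The height 1 - rho R0 P.2 determines P.2; points P with the same P.2 have
saddles that are translates of each other along x_1. *)
Lemma saddle_inj (R0 : R) P P' y y' : 1 < R0 ->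
  saddle R0 P y = saddle R0 P' y' -> P = P'.
Proof.
case: P P' => [p1 p2] [q1 q2] R1 [/= e1 e2 ey].
have e : p2 = q2 by apply: (rho_inj R0) => //; lra.
by move: e1; rewrite ey e => e1; congr pair; lra.
Qed.

(** The sign of y_1 - y_2 is constant on each side of the square, nonnegative on
the bottom and right sides and nonpositive on the two others, so the absolute
value absorbs the case distinction in sigma. *)
Lemma sigma_saddle (R0 : R) P y : 1 < P.2 < R0 -> supnorm y = rho R0 P.2 ->
  sigma (P, y) = saddle R0 P y.
Proof.
move=> PR yc; have /andP[c0 _] := rho_itv _ _ PR.
case/andP: PR => P1 _; have [eb er et el] := sigma_side P1 c0 yc.
have /supnormP[] := yc; move: eb er et el; rewrite /saddle.
set c := rho R0 P.2 in c0 *; have cn0 : c != 0 by rewrite gt_eqF.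
case: y {yc} => y1 y2 /= eb er et el; rewrite !ler_norml.
move=> /andP[h1 h2] /andP[h3 h4] h.
have [e|e|e|e] : [\/ y2 = - c, y1 = c, y2 = c | y1 = - c].
  case: h; [case: (ger0P y1)|case: (ger0P y2)] => _ h;
  by [apply: Or42; lra|apply: Or44; lra|apply: Or43; lra|apply: Or41; lra].
- by rewrite eb // ger0_norm; [congr ((_, _), _); rewrite e; field|lra].
- by rewrite er // ger0_norm; [congr ((_, _), _); rewrite e; field|lra].
- by rewrite et // ler0_norm; [congr ((_, _), _); rewrite e; field|lra].
- by rewrite el // ler0_norm; [congr ((_, _), _); rewrite e; field|lra].
Qed.

Lemma supnormZ (c : R) y : 0 <= c -> supnorm (c *: y) = c * supnorm y.
Proof. by move=> c0; rewrite /supnorm /= !normrM ger0_norm // maxr_pMr. Qed.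

Lemma Gmap_saddle (R0 : R) P v : 1 < P.2 < R0 -> square v ->
  Gmap (a1 R0 P) (a2 R0 P) v = saddle R0 P (rho R0 P.2 *: v).
Proof.
move=> /rho_itv/andP[]; rewrite /Gmap /a1 /a2 /saddle /=.
set c := rho R0 P.2 => c0 _ /supnormP[].
have cn0 : c != 0 by rewrite gt_eqF.
case: v => v1 v2 /=; rewrite !ler_norml => /andP[h1 h2] /andP[h3 h4] h.
have -> : 1 - (1 - c) = c by lra.
congr ((_, _), _); rewrite /GRing.scale /= -mulrBr normrM (gtr0_norm c0).
have [e2|n1] := eqVneq v2 (-1).
  by rewrite ger0_norm ?e2; [field|lra].
have [e1|n2] := eqVneq v1 1.
  by rewrite ger0_norm ?e1; [field|lra].
have [e2|n3] := eqVneq v2 1.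
  by rewrite ler0_norm ?e2; [field|lra].
have e1 : v1 = -1.
  case: h => [|h]; first by case: (ger0P v1) => _ h; [rewrite h eqxx in n2|lra].
  by move: h n1 n3; case: (ger0P v2) => _ h /eqP ? /eqP ?; lra.
by rewrite ler0_norm ?e1; [field|lra].
Qed.

Lemma attaching_circle_saddle (R0 : R) P : 1 < P.2 < R0 ->
  attaching_circle R0 P =
  [set saddle R0 P y | y in [set y | supnorm y = rho R0 P.2]].
Proof.
move=> PR; apply/seteqP; split=> _ [y yc <-]; exists y => //.
  by rewrite (sigma_saddle R0).
by rewrite (sigma_saddle R0).
Qed.

Lemma attaching_circle_SS (R0 : R) P : 1 < P.2 < R0 ->
  attaching_circle R0 P = SS (a1 R0 P) (a2 R0 P).
Proof.
move=> PR; have /andP[c0 _] := rho_itv _ _ PR.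
rewrite attaching_circle_saddle //; apply/seteqP; split=> _ [y /= yc <-].
  exists ((rho R0 P.2)^-1 *: y).
    by rewrite /square /= supnormZ ?invr_ge0 ?ltW // yc mulVf ?gt_eqF.
  rewrite Gmap_saddle // ?scalerA ?mulfV ?gt_eqF ?scale1r //.
  by rewrite /square /= supnormZ ?invr_ge0 ?ltW // yc mulVf ?gt_eqF.
exists (rho R0 P.2 *: y); last by rewrite Gmap_saddle.
by rewrite /= supnormZ ?ltW // yc mulr1.
Qed.

(** The half-width P.2 - 1 + rho R0 P.2 of the circle is less than R0. *)
Lemma Rect_a (R0 : R) r P : 1 < P.2 < R0 -> `|P.1| + R0 <= r ->
  Rect r (a1 R0 P) /\ Rect r (a2 R0 P).
Proof.
move=> PR Pr; have /andP[c0 c1] := rho_itv _ _ PR; case/andP: PR => P1 PR.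
have := ler_norm P.1; have := ler_norm (- P.1); rewrite normrN /Rect /= => *.
by split; split; apply/andP; split; lra.
Qed.

(** The minimum defining delta is attained at the distance 1 - x_2 = rho R0 P.2
to the top side of the rectangle: the left and right sides are at distance at
least 1 for this r, and the bottom one at distance 2 - rho R0 P.2. *)
Lemma saddle_S3 (R0 : R) r P y : 1 < P.2 < R0 -> `|P.1| + R0 + 1 <= r ->
  supnorm y = rho R0 P.2 -> S3 r (saddle R0 P y).
Proof.
move=> PR Pr yc; have /andP[c0 c1] := rho_itv _ _ PR.
have /supnormP[] := yc; rewrite /S3 /Rect /delta /saddle /= {}yc.
set c := rho R0 P.2 in c0 c1 *; case/andP: PR => P1 PR.
rewrite !ler_norml => /andP[h1 h2] /andP[h3 h4] _.
have := ler_norm P.1; have := ler_norm (- P.1); rewrite normrN => *.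
(* |y_1 - y_2| <= 2 c, so the first coordinate stays between P.1 - h and P.1 + h *)
set h := P.2 - 1 + c; set q := h / c * _.
have q0 : 0 <= q by rewrite mulr_ge0 ?divr_ge0 //; rewrite /h; lra.
have q1 : q <= h * 2.
  rewrite /q mulrAC ler_pdivrMr // -mulrA ler_wpM2l //; first by rewrite /h; lra.
  by rewrite ler_norml; apply/andP; split; lra.
have hh : h <= R0 by rewrite /h; lra.
split; first by split; apply/andP; split; lra.
have -> : 1 - (1 - c) = c by lra.
rewrite (min_r (y := c)); last lra.
by rewrite min_r // le_min; apply/andP; split; lra.
Qed.

End Saddle.

(** * Linking numbers from disjoint chains *)

Section Chains.
Context {R : realType}.
Notation pt := (cplane R).

(** The diagonal (p, s) is traversed once in each direction and cancels. *)
Lemma bounds_quad (p q s t : pt) :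
  bounds [:: (p, q, s); (p, s, t)] [:: p; q; s; t].
Proof.
move=> u v; rewrite /edge_coef /chain_edges /edges /=.
have sw (x y x' y' : pt) : ((x, y) == (x', y')) = ((y, x) == (y', x')).
  by rewrite !xpair_eqE andbC.
rewrite (sw s p u v) (sw s p v u); rewrite -!natz !natrD; ring.
Qed.

(** Disjoint chains are vacuously transverse and all the terms of their
intersection number vanish. *)
Lemma linking_number0 (r : R) (K K' : seq pt) (S S' : chain R) :
  polygon K `<=` S3 r -> polygon K' `<=` S3 r -> polygon K `&` polygon K' = set0 ->
  chain_in (D4 r) S -> chain_in (D4 r) S' -> bounds S K -> bounds S' K' ->
  (forall T T', T \in S -> T' \in S' -> ~ tri_meet T T') ->
  linking_number r K K' 0.
Proof.
move=> KS KS' KK' SD SD' SK SK' dSS'; split=> //; exists S, S'; split=> //.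
  move=> T T' TS TS' c c' bc bc' e; exfalso.
  by apply: (dSS' T T') => //; exists c, c'.
rewrite /intersection_number big_seq big1 // => T TS.
rewrite big_seq big1 // => T' TS'; case: ifPn => // /asboolP m.
by have := dSS' _ _ TS TS' m.
Qed.

End Chains.

(** * The disk bounded by the attaching circle *)

Section SaddleDisk.
Context {R : realType}.
Implicit Types (r : R) (P : plane R).

(** The square is cut along the diagonal y_1 = y_2, which is where [saddle] fails
to be affine. *)
Definition saddle_disk (R0 : R) P : chain R :=
  let w v1 v2 := saddle R0 P (rho R0 P.2 *: ((v1, v2) : plane R)) in
  [:: (w (-1) (-1), w 1 (-1), w 1 1); (w (-1) (-1), w 1 1, w (-1) 1)].

Lemma attaching_polygon_saddle (R0 : R) P : 1 < P.2 < R0 -> attaching_polygon R0 P =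
  [seq saddle R0 P (rho R0 P.2 *: v) | v <- corners R].
Proof.
move=> PR; have /andP[c0 _] := rho_itv _ _ PR.
apply/eq_in_map => v vc; rewrite (sigma_saddle R0) // supnormZ ?ltW //.
suff -> : supnorm v = 1 by rewrite mulr1.
by move: vc; rewrite !inE => /or4P[] /eqP -> ;
  rewrite /supnorm /= ?normrN !normr1 maxxx.
Qed.

(** On each of the two triangles y_1 - y_2 has a constant sign, so [saddle R0 P]
is affine there and commutes with barycentric combinations. *)
Lemma saddle_disk_graph (R0 : R) P T c : 0 < rho R0 P.2 ->
  T \in saddle_disk R0 P -> barycentric c ->
  tri_point T c = saddle R0 P (tri_point T c).2.
Proof.
case: c => [[s t] u] b0 TS [/= s0 t0 u0 e].
have {s s0 e} -> : s = 1 - t - u by lra.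
move: b0 TS; rewrite /saddle_disk /saddle /=; set b := rho R0 P.2 => b0.
have bn0 : b != 0 by rewrite gt_eqF.
have n0 x : `|b * x - b * x| = 0 by rewrite subrr normr0.
have n1 : `|b * 1 - b * -1| = 2 * b by rewrite ger0_norm; lra.
have n2 : `|b * -1 - b * 1| = 2 * b by rewrite ler0_norm; lra.
have bt : 0 <= b * t by rewrite mulr_ge0 // ltW.
have bu : 0 <= b * u by rewrite mulr_ge0 // ltW.
rewrite !inE => /orP[] /eqP ->; rewrite /tri_point /= !(n0, n1, n2).
  congr ((_, _), _); rewrite /GRing.scale /= /scale_pair /= /GRing.scale /=;
    last ring.
  by rewrite /= ger0_norm; [field|lra].
congr ((_, _), _); rewrite /GRing.scale /= /scale_pair /= /GRing.scale /=;
  last ring.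
by rewrite /= ler0_norm; [field|lra].
Qed.

(** The disks over two distinct points lie on the images of the corresponding
saddles, so [saddle_inj] makes them disjoint, however close the points are. *)
Lemma linking_attaching_polygons (R0 : R) r P P' : P != P' ->
  1 < P.2 < R0 -> 1 < P'.2 < R0 ->
  `|P.1| + R0 + 1 <= r -> `|P'.1| + R0 + 1 <= r ->
  linking_number r (attaching_polygon R0 P) (attaching_polygon R0 P') 0.
Proof.
move=> PP' PR PR' Pr Pr'.
have R1 : 1 < R0 by case/andP: PR; exact: lt_trans.
have sphere Q : 1 < Q.2 < R0 -> `|Q.1| + R0 + 1 <= r ->
    polygon (attaching_polygon R0 Q) `<=` S3 r.
  move=> QR Qr; rewrite attaching_polygonE // attaching_circle_saddle //.
  by move=> _ [y yc <-]; exact: saddle_S3.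
have ball Q : 1 < Q.2 < R0 -> `|Q.1| + R0 + 1 <= r ->
    chain_in (D4 r) (saddle_disk R0 Q).
  move=> QR Qr; have /andP[c0 _] := rho_itv _ _ QR.
  have D v1 v2 : supnorm ((v1, v2) : plane R) = 1 ->
      D4 r (saddle R0 Q (rho R0 Q.2 *: ((v1, v2) : plane R))).
    move=> v1E; have [|zR zd] := saddle_S3 R0 r Q (rho R0 Q.2 *: (v1, v2)) QR Qr.
      by rewrite supnormZ ?v1E ?mulr1 // ltW.
    by split; rewrite // zd.
  move=> T; rewrite !inE => /orP[] /eqP -> /=; split; apply: D;
    by rewrite /supnorm /= ?normrN !normr1 maxxx.
have bdry Q : 1 < Q.2 < R0 -> bounds (saddle_disk R0 Q) (attaching_polygon R0 Q).
  by move=> QR; rewrite attaching_polygon_saddle //; exact: bounds_quad.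
apply: (@linking_number0 _ _ _ _ (saddle_disk R0 P) (saddle_disk R0 P')).
- exact: sphere.
- exact: sphere.
- rewrite !attaching_polygonE // !attaching_circle_saddle //.
  apply/seteqP; split=> // _ [[y _ <-] [y' _ /esym/saddle_inj e]].
  by move/eqP: PP'; apply; exact: e.
- exact: ball.
- exact: ball.
- exact: bdry.
- exact: bdry.
move=> T T' TS TS' [c [c' [bc bc' e]]]; move/eqP: PP'; apply.
have /andP[c0 _] := rho_itv _ _ PR; have /andP[c0' _] := rho_itv _ _ PR'.
apply: (@saddle_inj _ R0 _ _ (tri_point T c).2 (tri_point T' c').2) => //.
by rewrite -!saddle_disk_graph.
Qed.

End SaddleDisk.

(** * Chambers that miss F are horizontally bounded *)

Section ChamberBound.
Context {R : realType} {n : nat}.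
Context (A : 'I_n -> affine_form R) (R0 : R).
Context (lin1_neq0 : forall i, lin1 (A i) != 0).

(** On H_i, x_1 = - (cst + lin2 * x_2) / lin1; summing the resulting bounds for
0 <= x_2 <= R0 over all the lines serves as a common bound, also when there is
no line. *)
Definition line_bound : R :=
  \sum_i (`|Defs.cst (A i)| + `|lin2 (A i)| * R0) / `|lin1 (A i)|.

Lemma line_bounded i x : line (A i) x -> 0 <= x.2 <= R0 -> `|x.1| <= line_bound.
Proof.
move=> Ax /andP[x0 xR]; have R0ge : 0 <= R0 by exact: le_trans xR.
rewrite /line_bound (bigD1 i) //= -[leLHS]addr0 lerD //; last first.
  by apply: sumr_ge0 => j _; rewrite divr_ge0 ?addr_ge0 ?mulr_ge0.
rewrite ler_pdivlMr ?normr_gt0 // -normrM.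
have -> : x.1 * lin1 (A i) = - (Defs.cst (A i) + lin2 (A i) * x.2).
  by move: Ax; rewrite /line /aeval /= => Ax; lra.
rewrite normrN (le_trans (ler_normD _ _)) // lerD2l normrM ler_wpM2l //.
by rewrite ger0_norm.
Qed.

(** Beyond the bound, the vertical segment from P to F meets no line, so it
stays in the chamber of P, which would then meet F. *)
Lemma chF_bounded C P : chF A C -> C P -> 0 <= P.2 <= R0 -> `|P.1| <= line_bound.
Proof.
move=> [[Q QA <-] CF] CP /andP[P0 PR]; rewrite leNgt; apply/negP => far.
have seg : [set (P.1, s) | s in `[0, P.2]] `<=` complement A.
  move=> z [s] /=; rewrite in_itv /= => /andP[s0 sP] <- [i _ Ai].
  have := @line_bounded i (P.1, s) Ai; rewrite /= s0 (le_trans sP PR) => /(_ isT).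
  by rewrite leNgt far.
have conn : connected [set (P.1, s) | s in `[0, P.2]].
  apply: connected_continuous_connected; first exact: segment_connected.
  apply: continuous_subspaceT => s.
  exact: (cvg_pair (cvg_cst P.1) (@cvg_id _ (nbhs s))).
suff : (connected_component (complement A) Q `&` @Fline R) (P.1, 0) by rewrite CF.
split=> //; apply: connected_component_trans CP _.
apply: (connected_component_max _ seg conn); last first.
  by exists 0 => //=; rewrite in_itv /= lexx.
by exists P.2; [rewrite /= in_itv /= P0 lexx|rewrite -surjective_pairing].
Qed.

End ChamberBound.

Lemma normalized_lin1_gt0 {R : realType} {n : nat} (A : 'I_n -> affine_form R)
    (a theta : 'I_n -> R) (R0 : R) :
  normalized A a theta R0 -> forall i, 0 < lin1 (A i).
Proof.
move=> hA i; have h1 : a i - 1 < a i by lra.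
have h2 : a i < a i + 1 by lra.
have := norm_neg hA h1; have := norm_pos hA h2; rewrite /aeval /=; lra.
Qed.

Theorem theorem4p2 (R : realType) (n : nat) (A : 'I_n -> affine_form R)
    (a theta : 'I_n -> R) (R0 : R) (hA : normalized A a theta R0) :
  exists r0 : R, forall r : R, r0 <= r ->
  forall C : set (plane R), chF A C ->
  forall P : plane R, C P -> 1 < P.2 < R0 ->
    [/\ SS_admissible r (a1 R0 P) (a2 R0 P),
        attaching_circle R0 P = SS (a1 R0 P) (a2 R0 P) &
        framing r R0 C P 0].
Proof.
(* line_bound bounds |P.1|, R0 the half-width of the circle, and 1 bounds the
   value rho R0 P.2 that delta has to take on it *)
exists (line_bound A R0 + R0 + 1) => r rr0 C CF P CP PR.
have lin1n0 i : lin1 (A i) != 0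
    by rewrite gt_eqF // (normalized_lin1_gt0 _ _ _ _ hA).
have far Q : C Q -> 1 < Q.2 < R0 -> `|Q.1| + R0 + 1 <= r.
  move=> CQ QR; apply: le_trans rr0; rewrite !lerD2r.
  by apply: (chF_bounded _ _ lin1n0 _ _ CF CQ); lra.
have /andP[c0 c1] := rho_itv _ _ PR.
split.
- have [|ra1 ra2] := Rect_a R0 r P PR; first by have := far _ CP PR; lra.
  by split=> //=; lra.
- exact: attaching_circle_SS.
- rewrite /framing near_withinE.
  have /andP[P1 PR0] := PR.
  have near1 : \forall P' \near P, 1 < P'.2.
    exact: (@cvg_snd _ _ (nbhs P.1) (nbhs P.2) _ [set h | 1 < h] (lt_nbhsr P1)).
  have near2 : \forall P' \near P, P'.2 < R0.
    exact: (@cvg_snd _ _ (nbhs P.1) (nbhs P.2) _ [set h | h < R0] (lt_nbhsl PR0)).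
  near=> P' => PP' CP'; have P'R : 1 < P'.2 < R0 by apply/andP; split; near: P'.
  by apply: linking_attaching_polygons => //; rewrite ?(eq_sym P) ?far.
Unshelve. all: by end_near.
Qed.
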